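(* Let $P=(p,q)\in\mathbb{R}^2$ with $4p+q^2>0$, let $A=(-1,0)$, and let $\mathcal{F}_c$ be the closed curve contained in Beloch's curve of $P$ between the two passages through the self-intersection point $P$. Then: (a) $p>1$ $\iff$ the rotation number of $\mathcal{F}_c$ around $A$ is $1$; (b) $p<1$ $\iff$ the rotation number of $\mathcal{F}_c$ around $A$ is $0$, or $A=P$; (c) $p=1$ $\iff$ $A$ is on $\mathcal{F}_c$ and $A\neq P$.
   Context: For $r\in\mathbb{R}$ let $A'=(1,2r)$, let $l_r$ be the perpendicular bisector of $A=(-1,0)$ and $A'$ (the line $x+ry-r^2=0$), and let $P'(r)$ be the reflection of $P=(p,q)$ in $l_r$. Beloch's curve of $P$ is $\mathcal{F}=\{P'(r):r\in\mathbb{R}\}\cup\{P\}$, which is the cubic curve $2(q-y)^2-(q+y)(q-y)(p-x)-(p-x)^2(p+x)=0$. When $4p+q^2>0$ there are exactly two values $r_1<r_2$ of $r$ with $P'(r)=P$; $\mathcal{F}_c$ is the closed curve $r\mapsto P'(r)$, $r\in[r_1,r_2]$, oriented by increasing $r$. The rotation number of a piecewise smooth closed curve $\Gamma$ around a point $A$ not on $\Gamma$ is the winding number (counterclockwise positive) of the map $P'\mapsto \overrightarrow{AP'}/|\overrightarrow{AP'}|\in S^1$ as $P'$ goes along $\Gamma$ according to the parameter; it is defined only when $A$ is not on $\Gamma$ (so a statement that it equals $0$ or $1$ includes that $A\notin\Gamma$). *)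

(* Defs.v *)
From Stdlib Require Import Reals Lra Psatz ZArith.
From Coquelicot Require Import Coquelicot.
Open Scope R_scope.

Definition vec (M N : R * R) : R * R := (fst N - fst M, snd N - snd M).

Definition dot (u v : R * R) : R := fst u * fst v + snd u * snd v.

Definition vnorm (u : R * R) : R := sqrt (dot u u).

Definition vscale (k : R) (u : R * R) : R * R := (k * fst u, k * snd u).

Definition midpoint (M N : R * R) : R * R :=
  ((fst M + fst N) / 2, (snd M + snd N) / 2).

(* Reflection of X in the line through M with normal vector n <> 0. *)
Definition reflection (M n X : R * R) : R * R :=
  let k := 2 * dot (vec M X) n / dot n n in
  (fst X - k * fst n, snd X - k * snd n).

(* The perpendicular bisector of U and V is the line through their midpoint
   with normal vector UV. *)
Definition bisector_reflection (U V X : R * R) : R * R :=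
  reflection (midpoint U V) (vec U V) X.

Definition ptA : R * R := (-1, 0).

Definition ptA' (r : R) : R * R := (1, 2 * r).

(* P'(r) *)
Definition beloch (P : R * R) (r : R) : R * R :=
  bisector_reflection ptA (ptA' r) P.

Definition on_arc (gamma : R -> R * R) (a b : R) (M : R * R) : Prop :=
  exists t, a <= t <= b /\ gamma t = M.

(* For a closed curve gamma on [a,b], the winding number k of
   t |-> M gamma(t) / |M gamma(t)| is measured by a continuous determination
   theta of its argument on [a,b]; k does not depend on the choice of theta. *)
Definition is_rotation_number
    (gamma : R -> R * R) (a b : R) (M : R * R) (k : Z) : Prop :=
  gamma a = gamma b /\
  ~ on_arc gamma a b M /\
  exists theta : R -> R,
    continuous_on (fun t => a <= t <= b) theta /\
    (forall t, a <= t <= b ->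
       vscale (/ vnorm (vec M (gamma t))) (vec M (gamma t))
       = (cos (theta t), sin (theta t))) /\
    theta b - theta a = 2 * PI * IZR k.

Lemma belochE (p q r : R) :
  beloch (p, q) r =
  (p - 2 * (p + r * q - r ^ 2) / (1 + r ^ 2),
   q - 2 * (p + r * q - r ^ 2) / (1 + r ^ 2) * r).
Proof.
  unfold beloch, bisector_reflection, reflection, midpoint, vec, dot, ptA, ptA'.
  simpl. f_equal; field; nra.
Qed.

Lemma beloch_fixed (p q r : R) :
  beloch (p, q) r = (p, q) <-> p + r * q - r ^ 2 = 0.
Proof.
  rewrite belochE; split.
  - intros H; apply (f_equal fst) in H; cbn [fst] in H.
    assert (D : 1 + r ^ 2 <> 0) by nra.
    set (k := 2 * (p + r * q - r ^ 2) / (1 + r ^ 2)) in H.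
    assert (E : k = 0) by lra.
    assert (F : 2 * (p + r * q - r ^ 2)
                = 2 * (p + r * q - r ^ 2) / (1 + r ^ 2) * (1 + r ^ 2))
      by (field; exact D).
    fold k in F; rewrite E in F; lra.
  - intros ->; f_equal; field; nra.
Qed.

Lemma beloch_two_passages (p q : R) : 4 * p + q ^ 2 > 0 ->
  exists r1 r2, r1 < r2 /\
    forall r, beloch (p, q) r = (p, q) <-> r = r1 \/ r = r2.
Proof.
  intros H; set (s := sqrt (4 * p + q ^ 2)).
  assert (s0 : 0 < s) by (apply sqrt_lt_R0; lra).
  assert (ss : s * s = 4 * p + q ^ 2) by (apply sqrt_sqrt; lra).
  exists ((q - s) / 2), ((q + s) / 2); split; [lra|].
  intros r; rewrite beloch_fixed; split.
  - intros E.
    assert (F : (r - (q - s) / 2) * (r - (q + s) / 2) = 0) by nra.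
    destruct (Rmult_integral _ _ F); [left|right]; lra.
  - intros [-> | ->]; nra.
Qed.

(* Main.v *)
(** The reflection in [l_r] carries [A P'(r)] to [A' P], so, writing vectors as
complex numbers, [A P'(r) = (1+ir)^2 / (1+r^2) * ((1-p) + i(q-2r))]. Hence [A]
lies on the curve only if [p = 1], and for [p <> 1] an argument of [A P'(r)] is
[2 atan r + atan ((q-2r)/(1-p))], shifted by [PI] when [p > 1]. Since
[r1 + r2 = q] and [r1 r2 = -p], this argument grows by
[2 (atan r2 - atan r1 - atan ((r2-r1)/(1+r1 r2)))], which by the subtraction
formula for the arctangent is [0] when [r1 r2 > -1] and [2 PI] when
[r1 r2 < -1]. *)

Require Import Defs.
From Stdlib Require Import Reals ZArith Lra.
From Coquelicot Require Import Coquelicot.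
Open Scope R_scope.

Lemma cos_lt_1 (x : R) : 0 < x <= PI -> cos x < 1.
Proof.
  intros Hx; pose proof (sin_gt_0 (x / 2) ltac:(lra) ltac:(lra)) as S.
  replace x with (2 * (x / 2)) by lra; rewrite cos_2a_sin; nra.
Qed.

(** Continuity is assumed only relative to the interval, so [f] is precomposed with the clamp [c]
    onto it, which is 1-Lipschitz on the whole line and fixes [a] and [b]. *)
Lemma continuous_on_IVT (f : R -> R) (a b y : R) :
  a <= b -> continuous_on (fun t => a <= t <= b) f -> f a <= y <= f b ->
  exists t, a <= t <= b /\ f t = y.
Proof.
  intros ab cf Hy.
  set (c := fun t => Rmax a (Rmin b t)).
  assert (cin : forall t, a <= c t <= b).
  { intros t; unfold c; split; [apply Rmax_l | apply Rmax_lub; [lra | apply Rmin_l]]. }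
  assert (ca : c a = a) by (unfold c; rewrite Rmin_right, Rmax_left by lra; reflexivity).
  assert (cb : c b = b) by (unfold c; rewrite Rmin_left, Rmax_right by lra; reflexivity).
  destruct (IVT_gen (fun t => f (c t)) a b y) as [t [Ht Et]].
  - intros t; apply continuity_pt_filterlim.
    apply (filterlim_comp _ _ _ c f _ (within (fun t => a <= t <= b) (locally (c t)))).
    + intros Q [e He]; exists e; intros s Hs; apply He; [|apply cin].
      change (Rabs (s - t) < e) in Hs; change (Rabs (c s - c t) < e).
      apply Rle_lt_trans with (2 := Hs).
      unfold c, Rmax, Rmin; destruct (Rle_dec b s), (Rle_dec b t);
        repeat destruct Rle_dec; unfold Rabs; repeat destruct Rcase_abs; lra.
    + apply cf, cin.
  - rewrite ca, cb; rewrite Rmin_left, Rmax_right by lra; exact Hy.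
  - exists (c t); split; [apply cin | exact Et].
Qed.

(** The difference [d] of two arguments of the same vector satisfies [cos d = 1]. If it grew, it
    would pass through a value [d a + x] with [0 < x <= PI], where its cosine is less than 1.
    Exchanging [f] and [g] gives the reverse inequality. *)
Lemma argument_increment_le (f g : R -> R) (a b : R) : a <= b ->
  continuous_on (fun t => a <= t <= b) f ->
  continuous_on (fun t => a <= t <= b) g ->
  (forall t, a <= t <= b -> (cos (f t), sin (f t)) = (cos (g t), sin (g t))) ->
  f b - f a <= g b - g a.
Proof.
  intros ab cf cg E; set (d := fun t => f t - g t).
  assert (cd : continuous_on (fun t => a <= t <= b) d).
  { intros t Ht.
    apply (filterlim_comp_2 (G := locally (f t)) (H := locally (- g t))
             f (fun s => - g s) Rplus).
    - apply cf, Ht.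
    - apply (filterlim_comp _ _ _ g Ropp _ (locally (g t))); [apply cg, Ht|].
      apply (filterlim_opp (g t)).
    - apply (filterlim_plus (f t) (- g t)). }
  assert (d1 : forall t, a <= t <= b -> cos (d t) = 1).
  { intros t Ht; injection (E t Ht) as Ec Es; unfold d.
    rewrite cos_minus, Ec, Es; pose proof (sin2_cos2 (g t)); unfold Rsqr in *; lra. }
  assert (d0 : sin (d a) = 0).
  { pose proof (sin2_cos2 (d a)); rewrite (d1 a ltac:(lra)) in *; unfold Rsqr in *; nra. }
  apply Rnot_lt_le; intros lt.
  pose proof PI_RGT_0.
  (* The cap [PI] ensures [cos x < 1]; the cap [d b - d a] ensures that [d] attains [d a + x]. *)
  set (x := Rmin PI (d b - d a)).
  assert (x0 : 0 < x <= PI).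
  { unfold x; split; [apply Rmin_pos; unfold d; lra | apply Rmin_l]. }
  destruct (continuous_on_IVT d a b (d a + x) ab cd) as [t [Ht Et]].
  { pose proof (Rmin_r PI (d b - d a)); fold x in H0; lra. }
  pose proof (d1 t Ht) as C; rewrite Et, cos_plus, d0, (d1 a ltac:(lra)) in C.
  pose proof (cos_lt_1 x x0); lra.
Qed.

Lemma is_rotation_number_unique (gamma : R -> R * R) (a b : R) (M : R * R) (k l : Z) :
  a <= b -> is_rotation_number gamma a b M k -> is_rotation_number gamma a b M l ->
  k = l.
Proof.
  intros ab (_ & _ & f & cf & Ef & If) (_ & _ & g & cg & Eg & Ig).
  assert (fg : f b - f a <= g b - g a)
    by (apply argument_increment_le; trivial; intros; rewrite <- Ef, <- Eg; trivial).
  assert (gf : g b - g a <= f b - f a)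
    by (apply argument_increment_le; trivial; intros; rewrite <- Ef, <- Eg; trivial).
  pose proof PI_RGT_0; apply eq_IZR; apply Rmult_eq_reg_l with (2 * PI); lra.
Qed.

Lemma tan_atan_sub (u v : R) :
  1 + u * v <> 0 -> tan (atan u - atan v) = (u - v) / (1 + u * v).
Proof.
  intros H; unfold tan; rewrite sin_minus, cos_minus, !sin_atan, !cos_atan.
  pose proof (sqrt_lt_R0 (1 + u²) ltac:(unfold Rsqr; nra)).
  pose proof (sqrt_lt_R0 (1 + v²) ltac:(unfold Rsqr; nra)).
  field; repeat split; try lra.
Qed.

(** The factor [m] is [cos (atan u) * cos (atan v)]. The sign of [1 + u * v] thus tells on which
    side of [PI / 2] a difference of arctangents in [(0, PI)] lies. *)
Lemma cos_atan_sub_sign (u v : R) :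
  exists m, 0 < m /\ cos (atan u - atan v) = m * (1 + u * v).
Proof.
  pose proof (sqrt_lt_R0 (1 + u²) ltac:(unfold Rsqr; nra)) as Hu.
  pose proof (sqrt_lt_R0 (1 + v²) ltac:(unfold Rsqr; nra)) as Hv.
  exists (/ (sqrt (1 + u²) * sqrt (1 + v²))); split.
  - apply Rinv_0_lt_compat, Rmult_lt_0_compat; trivial.
  - rewrite cos_minus, !sin_atan, !cos_atan; field; lra.
Qed.

Lemma atan_sub_pos (u v : R) : v < u -> 0 < 1 + u * v ->
  atan u - atan v = atan ((u - v) / (1 + u * v)).
Proof.
  intros vu H; rewrite <- tan_atan_sub by lra; symmetry; apply atan_tan.
  pose proof (atan_increasing v u vu); pose proof (atan_bound u); pose proof (atan_bound v).
  split; [lra|]; apply Rnot_le_lt; intros Hle.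
  destruct (cos_atan_sub_sign u v) as (m & m0 & E).
  pose proof (cos_le_0 (atan u - atan v) ltac:(lra) ltac:(lra)); nra.
Qed.

(** Here the cosine is negative, so the difference lies in [(PI / 2, PI)]; subtracting [PI] keeps
    the tangent and moves it into the range of [atan]. *)
Lemma atan_sub_neg (u v : R) : v < u -> 1 + u * v < 0 ->
  atan u - atan v = PI + atan ((u - v) / (1 + u * v)).
Proof.
  intros vu H; rewrite <- tan_atan_sub by lra.
  pose proof (atan_increasing v u vu); pose proof (atan_bound u); pose proof (atan_bound v).
  destruct (cos_atan_sub_sign u v) as (m & m0 & E).
  assert (x0 : 0 < atan u - atan v < PI) by lra.
  set (x := atan u - atan v) in *; clearbody x.
  assert (C : cos x < 0) by nra.
  assert (x2 : PI / 2 < x).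
  { apply Rnot_le_lt; intros Hle; pose proof (cos_ge_0 x ltac:(lra) ltac:(lra)); lra. }
  replace (tan x) with (tan (x - PI)); [rewrite atan_tan; lra|].
  unfold tan; rewrite sin_minus, cos_minus, sin_PI, cos_PI; field; lra.
Qed.

Lemma beloch_eq_A (p q r : R) : beloch (p, q) r = ptA -> p = 1.
Proof.
  rewrite belochE; unfold ptA; intros E.
  pose proof (f_equal fst E) as E1; pose proof (f_equal snd E) as E2.
  cbn [fst snd] in E1, E2; clear E.
  assert (K : 2 * (p + r * q - r ^ 2) / (1 + r ^ 2) * (1 + r ^ 2)
              = 2 * (p + r * q - r ^ 2)) by (field; nra).
  set (k := 2 * (p + r * q - r ^ 2) / (1 + r ^ 2)) in *; clearbody k.
  assert (q = k * r) by lra; assert (p = k - 1) by lra; subst q p.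
  (* With these values of [p] and [q], [K] reads [k * (1 + r ^ 2) = 2 * (k - 1) * (1 + r ^ 2)];
     hence [k = 2] and [p = 1]. *)
  assert (F : (k - 2) * (1 + r ^ 2) = 0) by lra.
  destruct (Rmult_integral _ _ F); [lra | nra].
Qed.

(** The shift [c] treats both signs of [1 - p] at once: [cos c] is 1 or -1 and has the sign of
    [1 - p]. *)
Lemma beloch_argument (p q r c : R) : sin c = 0 -> 0 < (1 - p) * cos c ->
  let theta := c + 2 * atan r + atan ((q - 2 * r) / (1 - p)) in
  let v := vec ptA (beloch (p, q) r) in
  vscale (/ vnorm v) v = (cos theta, sin theta).
Proof.
  intros c0 c1; set (u := (q - 2 * r) / (1 - p)); intros theta v.
  assert (p1 : 1 - p <> 0) by (intros E; rewrite E in c1; lra).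
  pose proof (sqrt_lt_R0 (1 + u²) ltac:(unfold Rsqr; nra)) as u0.
  pose proof (sqrt_lt_R0 (1 + r²) ltac:(unfold Rsqr; nra)) as r0.
  assert (rr : sqrt (1 + r²) * sqrt (1 + r²) = 1 + r ^ 2)
    by (rewrite sqrt_sqrt; unfold Rsqr; nra).
  assert (cc : cos c * cos c = 1)
    by (pose proof (sin2_cos2 c); rewrite c0 in *; unfold Rsqr in *; lra).
  (* This is the length of [A'P], hence of [AP'(r)], since [(1 - p) * cos c] is the absolute value
     of [1 - p]. *)
  set (m := (1 - p) * cos c * sqrt (1 + u²)).
  assert (m0 : 0 < m) by (apply Rmult_lt_0_compat; trivial).
  assert (C2 : cos (2 * atan r) = (1 - r ^ 2) / (1 + r ^ 2)).
  { rewrite cos_2a, cos_atan, sin_atan, <- rr; apply Rminus_diag_uniq; field; lra. }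
  assert (S2 : sin (2 * atan r) = 2 * r / (1 + r ^ 2)).
  { rewrite sin_2a, cos_atan, sin_atan, <- rr; field; lra. }
  assert (Ev : v = vscale m (cos theta, sin theta)).
  { assert (D : 1 + r ^ 2 <> 0) by nra.
    unfold v, theta, vscale, vec; rewrite belochE; cbn [fst snd ptA].
    rewrite !cos_plus, !sin_plus, !cos_plus, C2, S2, c0, sin_atan, cos_atan.
    unfold m; f_equal.
    (* One factor [cos c] comes from [m], the other from expanding the angle sum with
       [sin c = 0]. *)
    - transitivity ((cos c * cos c) * (((1 - p) * (1 - r ^ 2) - 2 * r * ((1 - p) * u)) / (1 + r ^ 2))).
      + rewrite cc; unfold u; field; lra.
      + field; lra.
    - transitivity ((cos c * cos c) * (((1 - p) * (2 * r) + (1 - r ^ 2) * ((1 - p) * u)) / (1 + r ^ 2))).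
      + rewrite cc; unfold u; field; lra.
      + field; lra. }
  assert (N : vnorm v = m).
  { rewrite Ev; unfold vnorm, dot, vscale; cbn [fst snd].
    pose proof (sin2_cos2 theta); unfold Rsqr in *.
    replace (_ + _) with (m * m) by nra; apply sqrt_square; lra. }
  rewrite N, Ev; unfold vscale; cbn [fst snd]; f_equal; field; lra.
Qed.

Lemma beloch_rotation (p q r1 r2 c : R) (k : Z) :
  r1 <= r2 -> beloch (p, q) r1 = beloch (p, q) r2 ->
  sin c = 0 -> 0 < (1 - p) * cos c ->
  2 * (atan r2 - atan r1)
    + (atan ((q - 2 * r2) / (1 - p)) - atan ((q - 2 * r1) / (1 - p))) = 2 * PI * IZR k ->
  is_rotation_number (beloch (p, q)) r1 r2 ptA k.
Proof.
  intros le E c0 c1 I; split; [exact E | split].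
  - intros (t & _ & Et); apply beloch_eq_A in Et; subst p; lra.
  - exists (fun r => c + 2 * atan r + atan ((q - 2 * r) / (1 - p))); repeat split.
    + apply continuous_on_forall; intros t _.
      apply (ex_derive_continuous (K := R_AbsRing) (V := R_NormedModule)).
      auto_derive; trivial.
    + intros t _; apply (beloch_argument p q t c c0 c1).
    + lra.
Qed.

Theorem theorem4p10 (p q : R) (hpq : 4 * p + q ^ 2 > 0)
    (r1 r2 : R) (hr : r1 < r2)
    (h1 : beloch (p, q) r1 = (p, q)) (h2 : beloch (p, q) r2 = (p, q)) :
  (p > 1 <-> is_rotation_number (beloch (p, q)) r1 r2 ptA 1) /\
  (p < 1 <-> is_rotation_number (beloch (p, q)) r1 r2 ptA 0 \/ ptA = (p, q)) /\
  (p = 1 <-> on_arc (beloch (p, q)) r1 r2 ptA /\ ptA <> (p, q)).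
Proof.
  assert (hclosed : beloch (p, q) r1 = beloch (p, q) r2) by congruence.
  pose proof (proj1 (beloch_fixed p q r1) h1) as e1.
  pose proof (proj1 (beloch_fixed p q r2) h2) as e2.
  (* The difference of [e2] and [e1] is [(r2 - r1) * (q - r1 - r2) = 0]. *)
  assert (hq : q = r1 + r2) by (apply Rmult_eq_reg_l with (r2 - r1); nra).
  assert (hp : p = - (r2 * r1)) by (subst q; lra).
  (* Since [q - 2 * r2 = r1 - r2], [q - 2 * r1 = r2 - r1] and [1 - p = 1 + r2 * r1], the two slopes
     are opposite. *)
  assert (I : p <> 1 -> atan ((q - 2 * r2) / (1 - p)) - atan ((q - 2 * r1) / (1 - p))
              = - 2 * atan ((r2 - r1) / (1 + r2 * r1))).
  { intros p1.
    replace ((q - 2 * r2) / (1 - p)) with (- ((r2 - r1) / (1 + r2 * r1)))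
      by (rewrite hq, hp; field; lra).
    replace ((q - 2 * r1) / (1 - p)) with ((r2 - r1) / (1 + r2 * r1))
      by (rewrite hq, hp; field; lra).
    rewrite atan_opp; lra. }
  assert (gt : p > 1 -> is_rotation_number (beloch (p, q)) r1 r2 ptA 1).
  { intros p1; apply beloch_rotation with PI; try lra; trivial.
    - apply sin_PI.
    - rewrite cos_PI; lra.
    - rewrite I, atan_sub_neg by lra; lra. }
  assert (lt : p < 1 -> is_rotation_number (beloch (p, q)) r1 r2 ptA 0).
  { intros p1; apply beloch_rotation with 0; try lra; trivial.
    - apply sin_0.
    - rewrite cos_0; lra.
    - rewrite I, atan_sub_pos by lra; lra. }
  assert (eq : p = 1 -> on_arc (beloch (p, q)) r1 r2 ptA).
  (* For [r = q / 2] the point [A'] is [(1, q) = P], whose reflection is [A]; this [r] is the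
     midpoint of [[r1, r2]]. *)
  { intros p1; exists (q / 2); split; [lra|].
    rewrite belochE, p1; unfold ptA; f_equal; field; nra. }
  assert (off : forall k, is_rotation_number (beloch (p, q)) r1 r2 ptA k -> p <> 1).
  { intros k (_ & H & _) p1; apply H, eq, p1. }
  (* At [A] the quantity [4 * p + q ^ 2] equals -4. *)
  assert (PA : ptA <> (p, q)).
  { unfold ptA; intros H; injection H as H1 H2; rewrite <- H1, <- H2 in hpq; lra. }
  split; [split; [exact gt|] | split; split].
  (* The converses go by trichotomy: [p = 1] puts [A] on the curve, and the opposite strict
     inequality yields the other rotation number, against uniqueness. *)
  - intros H; destruct (Rtotal_order p 1) as [H1 | [H1 | H1]]; trivial.
    + discriminate (is_rotation_number_unique _ _ _ _ _ _ (Rlt_le _ _ hr) H (lt H1)).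
    + destruct (off _ H H1).
  - intros H; left; apply lt, H.
  - intros [H | H]; [|destruct (PA H)].
    destruct (Rtotal_order p 1) as [H1 | [H1 | H1]]; trivial.
    + destruct (off _ H H1).
    + discriminate (is_rotation_number_unique _ _ _ _ _ _ (Rlt_le _ _ hr) H (gt H1)).
  - intros p1; split; [apply eq, p1 | exact PA].
  - intros [(t & _ & Et) _]; apply (beloch_eq_A _ _ _ Et).
Qed.
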